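(* Let $n\in\{2,3,4\}$ and let $\lambda_{ij} = \lambda_{ji} \in [0,1]$ be given for all $1\le i<j\le n$. Consider the existence of a random vector $(B_1,\ldots,B_n)$ with $P(B_i=1)=P(B_i=0)=1/2$ for all $i$ and with convexity parameters $\lambda(B_i,B_j)=\lambda_{ij}$ for all $i<j$. (1) When $n=2$, such a random vector $(B_1,B_2)$ exists for every $\lambda_{12}\in[0,1]$. (2) When $n=3$, such a random vector $(B_1,B_2,B_3)$ exists if and only if $$1 + 2\min\{\lambda_{23},\lambda_{12},\lambda_{13}\} \ge \lambda_{23}+\lambda_{12}+\lambda_{13} \ge 1.$$ (3) When $n=4$, such a random vector $(B_1,B_2,B_3,B_4)$ exists if and only if $$\ell \le u+1 \quad\text{and}\quad 1\le u,$$ where $$\ell = \max(\lambda_{14}+\lambda_{24}+\lambda_{13}+\lambda_{23},\ \lambda_{14}+\lambda_{34}+\lambda_{12}+\lambda_{23},\ \lambda_{24}+\lambda_{34}+\lambda_{12}+\lambda_{13}),$$ $$u = \min_{\{i,j,k\}} \left(\lambda_{ij}+\lambda_{jk}+\lambda_{ik}\right),$$ the minimum being over all three-element subsets $\{i,j,k\}$ of $\{1,2,3,4\}$.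
   Context: For a cdf $F$, the pseudoinverse is $F^{-1}(u) = \inf\{x : F(x)\ge u\}$. The correlation is $\operatorname{corr}(X,Y) = \frac{E[XY]-E[X]E[Y]}{\operatorname{sd}(X)\operatorname{sd}(Y)}$. Convexity parameter: let $X,Y$ be (non-degenerate) random variables with finite second moments and cdfs $F_X$, $F_Y$. Let $U$ be uniform on $[0,1]$, and set $\rho^- = \operatorname{corr}(F_X^{-1}(U),F_Y^{-1}(1-U))$ and $\rho^+ = \operatorname{corr}(F_X^{-1}(U),F_Y^{-1}(U))$. By the Fréchet–Hoeffding bound there is a unique $\lambda\in[0,1]$ with $\operatorname{corr}(X,Y) = \lambda\rho^+ + (1-\lambda)\rho^-$. This $\lambda=\lambda(X,Y)$ is the convexity parameter of $X$ and $Y$. *)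

(* Defs.v *)
From HB Require Import structures.
From mathcomp Require Export all_boot all_order all_algebra.
From mathcomp Require Export all_classical all_reals all_analysis.

Set Implicit Arguments.
Unset Strict Implicit.
Unset Printing Implicit Defensive.

Import Order.TTheory GRing.Theory Num.Theory.
Import numFieldNormedType.Exports.

Local Open Scope classical_set_scope.
Local Open Scope ring_scope.

(* [inf] is the real infimum, which is 0 on sets that are empty or unbounded
   below.  For a cdf F this only affects u outside the open interval ]0, 1[,
   a null set for the uniform law on [0, 1]. *)
Definition pseudoinverse (R : realType) (F : R -> \bar R) (u : R) : R :=
  inf [set x : R | (u%:E <= F x)%E].

Definition sd d (T : measurableType d) (R : realType) (P : probability T R)
    (X : T -> R) : R :=
  Num.sqrt (fine 'V_P[X]).

(* X and Y are plain functions because [correlation] is also applied to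
   transforms of a uniform variable, given as functions on R. *)
Definition correlation d (T : measurableType d) (R : realType)
    (P : probability T R) (X Y : T -> R) : R :=
  (fine 'E_P[fun t => X t * Y t] - fine 'E_P[X] * fine 'E_P[Y])
    / (sd P X * sd P Y).

(* In [rho_plus] and [rho_minus] the uniform variable U is the identity on the
   probability space (R, uniform law on [0, 1]). *)
Definition rho_plus d (T : measurableType d) (R : realType)
    (P : probability T R) (X Y : {RV P >-> R}) : R :=
  correlation (uniform_prob (@ltr01 R))
    (fun u => pseudoinverse (cdf X) u)
    (fun u => pseudoinverse (cdf Y) u).

Definition rho_minus d (T : measurableType d) (R : realType)
    (P : probability T R) (X Y : {RV P >-> R}) : R :=
  correlation (uniform_prob (@ltr01 R))
    (fun u => pseudoinverse (cdf X) u)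
    (fun u => pseudoinverse (cdf Y) (1 - u)).

Definition finite_second_moment d (T : measurableType d) (R : realType)
    (P : probability T R) (X : {RV P >-> R}) : Prop :=
  ('E_P[fun t => (X t ^+ 2)%R] < +oo)%E.

Definition nondegenerate d (T : measurableType d) (R : realType)
    (P : probability T R) (X : {RV P >-> R}) : Prop :=
  ~ exists c : R, P (X @^-1` [set c]) = 1%E.

(* [unique Q l], from Corelib.Init.Logic, says that Q l holds and that any m
   with Q m equals l. *)
Definition is_convexity_parameter d (T : measurableType d) (R : realType)
    (P : probability T R) (X Y : {RV P >-> R}) (l : R) : Prop :=
  [/\ finite_second_moment X, finite_second_moment Y,
      nondegenerate X, nondegenerate Y &
      unique (fun m : R => 0 <= m <= 1 /\
        correlation P X Y = m * rho_plus X Y + (1 - m) * rho_minus X Y) l].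

Definition symmetric_unit_array (R : realType) n (lam : 'I_n -> 'I_n -> R) :
    Prop :=
  (forall i j, lam i j = lam j i) /\
  (forall i j : 'I_n, (i < j)%N -> 0 <= lam i j <= 1).

Definition bernoulli_vector_exists (R : realType) n (lam : 'I_n -> 'I_n -> R) :
    Prop :=
  exists (d : measure_display) (T : measurableType d) (P : probability T R)
         (B : 'I_n -> {RV P >-> R}),
    (forall i, P (B i @^-1` [set 1]) = (2^-1)%:E /\
               P (B i @^-1` [set 0]) = (2^-1)%:E) /\
    (forall i j : 'I_n, (i < j)%N ->
       is_convexity_parameter (B i) (B j) (lam i j)).

(* 'I_n is 0-based; [entry lam i j] is the entry with 1-based indices i, j. *)
Definition entry (R : realType) n (lam : 'I_n.+1 -> 'I_n.+1 -> R) (i j : nat) :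
    R :=
  lam (inord i.-1) (inord j.-1).

(* Main.v *)
Require Import Defs.
From mathcomp Require Import all_boot all_order all_algebra.
From mathcomp Require Import all_classical all_reals all_analysis.
From mathcomp Require Import measurable_realfun lra ring.

(** A convexity parameter of two fair bits is the probability that they agree.
    The quantile function of a fair bit is the indicator of ]1/2, 1], so the
    comonotone coupling has correlation 1, the antimonotone
    one has correlation -1, and corr(X, Y) = 2 l - 1.  On the other hand
    corr(X, Y) = 4 P(X = Y = 1) - 1.  Hence l = 2 P(X = Y = 1) = P(X = Y);
    this is [fair_bit_convexity_parameter].

    The question becomes: which arrays are of the form P(B_i = B_j)?  The
    disagreement probabilities 1 - P(B_i = B_j) = E|B_i - B_j| are averages of
    cut semimetrics (a cut separates the indices where B is 0 from those where
    B is 1), so they satisfy the triangle inequalities and sum to at most 2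
    over every triple ([bernoulli_vector_triangle]).  Conversely, if an array
    is an average of cuts, one draws a cut with the given weights and chooses
    by an independent fair coin which of its sides gets the value 1; the coin
    makes every marginal fair ([bernoulli_vector_of_cuts]).

    On at most four points the triangle inequalities are also sufficient.  The
    eight cuts of four points carry eight weights subject to seven linear
    equations, which leaves one free parameter t; nonnegativity of the weights
    gives four lower and four upper bounds for t, and the sixteen comparisons
    between them are precisely the triangle inequalities of the four triples
    ([four_point_cuts]).  Two or three points are the case where some of the
    four points coincide.  The inequalities in the theorem are these triangle
    inequalities, grouped: subtracting a triple sum from a four-cycle sum
    leaves an expression of the form l_ij + l_ik - l_jk. *)

Set Implicit Arguments.
Unset Strict Implicit.
Unset Printing Implicit Defensive.
Import Order.TTheory GRing.Theory Num.Theory.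
Local Open Scope classical_set_scope.
Local Open Scope ring_scope.

(** * Correlation of fair bits *)

(** X is a plain function so that quantile functions, which live on R with the
    uniform law, are covered too. *)
Definition fair_bit d (T : measurableType d) (R : realType)
    (P : probability T R) (X : T -> R) : Prop :=
  [/\ measurable_fun setT X, P (X @^-1` [set 1]) = (2^-1)%:E &
      P (X @^-1` [set 0]) = (2^-1)%:E].

Section correlation_of_fair_bits.
Context d (T : measurableType d) (R : realType) (P : probability T R).
Implicit Types X Y : T -> R.

Lemma ae_eq_expectation X Y : measurable_fun setT X -> measurable_fun setT Y ->
  {ae P, forall t, X t = Y t} -> ('E_P[X] = 'E_P[Y])%E.
Proof.
move=> mX mY XY; rewrite unlock; apply: ae_eq_integral => //.
- exact/measurable_EFinP.
- exact/measurable_EFinP.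
- by apply: filterS XY => t -> _.
Qed.

Lemma fair_bit_measurable_preimage X r : fair_bit P X ->
  measurable (X @^-1` [set r]).
Proof.
case=> mX _ _; rewrite -[_ @^-1` _]setTI.
by apply: mX => //; exact: measurable_set1.
Qed.

(** The two atoms exhaust the probability, so almost surely X is the indicator
    of the event X = 1; all moments below are read off from this. *)
Lemma fair_bit_ae_indic X : fair_bit P X ->
  {ae P, forall t, X t = \1_(X @^-1` [set 1]) t}.
Proof.
move=> fX; have [mX X1 X0] := fX.
have m1 := fair_bit_measurable_preimage 1 fX.
have m0 := fair_bit_measurable_preimage 0 fX.
exists (~` (X @^-1` [set 1] `|` X @^-1` [set 0])); split.
- by apply: measurableC; apply: measurableU.
- rewrite probability_setC; last exact: measurableU.
  have -> : (P (X @^-1` [set 1%R] `|` X @^-1` [set 0%R]) =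
             P (X @^-1` [set 1%R]) + P (X @^-1` [set 0%R]))%E.
    apply: measureU => //.
    by apply/seteqP; split => // t [/= -> /eqP]; rewrite oner_eq0.
  by rewrite X1 X0 -!EFinD; congr EFin; lra.
- apply: subsetC => t [/= Xt|/= Xt]; rewrite indicE.
    by rewrite mem_set.
  by rewrite memNset ?Xt//= Xt => /eqP; rewrite eq_sym oner_eq0.
Qed.

Lemma fair_bit_expectation X : fair_bit P X -> ('E_P[X] = (2^-1)%:E)%E.
Proof.
move=> fX; have [mX X1 _] := fX.
rewrite (ae_eq_expectation mX _ (fair_bit_ae_indic fX)).
  by rewrite expectation_indic//; exact: fair_bit_measurable_preimage.
by apply: measurable_indic; exact: fair_bit_measurable_preimage.
Qed.

Lemma fair_bit_expectationM X Y : fair_bit P X -> fair_bit P Y ->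
  'E_P[fun t => (X t * Y t)%R]%E = P (X @^-1` [set 1] `&` Y @^-1` [set 1]).
Proof.
move=> fX fY; have [mX _ _] := fX; have [mY _ _] := fY.
have mI : measurable (X @^-1` [set 1] `&` Y @^-1` [set 1]).
  by apply: measurableI; exact: fair_bit_measurable_preimage.
rewrite -expectation_indic//; apply: ae_eq_expectation.
- exact: measurable_funM.
- exact: measurable_indic.
apply: filterS2 (fair_bit_ae_indic fX) (fair_bit_ae_indic fY) => t -> ->.
by rewrite indicI.
Qed.

(** (X - 1/2)^2 = 1/4 almost surely, whichever value X takes. *)
Lemma fair_bit_sd X : fair_bit P X -> sd P X = 2^-1.
Proof.
move=> fX; have [mX _ _] := fX.
rewrite /sd /variance covariance.unlock (fair_bit_expectation fX)/=.
have -> : 'E_P[((X \- cst 2^-1) * (X \- cst 2^-1))%R]%E =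
          'E_P[cst (2^-1 ^+ 2)%R]%E.
  apply: ae_eq_expectation => //.
    by apply: measurable_funM; apply: measurable_funB.
  apply: filterS (fair_bit_ae_indic fX) => t Xt.
  change ((X t - 2^-1) * (X t - 2^-1) = 2^-1 ^+ 2).
  by rewrite Xt indicE; case: (t \in _) => /=; field.
by rewrite expectation_cst /= sqrtr_sqr ger0_norm// invr_ge0.
Qed.

Lemma fair_bit_correlation X Y : fair_bit P X -> fair_bit P Y ->
  correlation P X Y =
    4 * fine (P (X @^-1` [set 1] `&` Y @^-1` [set 1])) - 1.
Proof.
move=> fX fY; rewrite /correlation fair_bit_expectationM// !fair_bit_sd//.
by rewrite !fair_bit_expectation//=; field.
Qed.

Lemma fair_bit_finite_second_moment (X : {RV P >-> R}) :
  fair_bit P X -> finite_second_moment X.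
Proof.
move=> fX; rewrite /finite_second_moment.
under eq_fun do rewrite expr2.
by rewrite fair_bit_expectationM// setIid; case: fX => _ -> _; rewrite ltry.
Qed.

Lemma fair_bit_nondegenerate (X : {RV P >-> R}) :
  fair_bit P X -> Defs.nondegenerate X.
Proof.
move=> fX [c Xc]; have [_ X1 _] := fX.
have half : (2^-1 : R) < 1 by lra.
have [c1|c1] := eqVneq c 1.
  by move: Xc; rewrite c1 X1 => -[] h; move: half; rewrite h ltxx.
have : (P (X @^-1` [set c]) <= P (~` (X @^-1` [set 1%R])))%E.
  apply: le_measure; rewrite ?inE.
  - exact: fair_bit_measurable_preimage.
  - by apply: measurableC; exact: fair_bit_measurable_preimage.
  - by move=> t /= -> h; move: c1; rewrite h eqxx.
rewrite probability_setC; last exact: fair_bit_measurable_preimage.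
by rewrite X1 Xc -EFinB lee_fin; lra.
Qed.

End correlation_of_fair_bits.

(** * Quantile functions of fair bits *)

Section quantile.
Context d (T : measurableType d) (R : realType) (P : probability T R).

Lemma ae_eq_probability (A B : set T) : measurable A -> measurable B ->
  {ae P, forall t, A t <-> B t} -> P A = P B.
Proof.
move=> mA mB AB; rewrite -!expectation_indic//.
apply: ae_eq_expectation => //; apply: filterS AB => t ABt.
rewrite !indicE; congr (_ %:R); congr nat_of_bool.
by apply/idP/idP; rewrite !inE => /ABt.
Qed.

Lemma fair_bit_cdf (X : {RV P >-> R}) r : fair_bit P X ->
  cdf X r = (if r < 0 then 0 else if r < 1 then 2^-1 else 1)%:E.
Proof.
move=> fX; have [mX X1 X0] := fX.
have mr : measurable (X @^-1` `]-oo, r]).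
  by rewrite -[_ @^-1` _]setTI; apply: mX.
have X01 := fair_bit_ae_indic fX.
rewrite /cdf /distribution /pushforward.
case: ifPn => [r0|]; last rewrite -leNgt => r0.
- rewrite -[RHS](measure0 P); apply: ae_eq_probability => //.
  apply: filterS X01 => t /= Xt; split => //.
  rewrite in_itv /= Xt indicE => h.
  have : (0 : R) <= (t \in X @^-1` [set 1])%:R by [].
  by move: r0 h; lra.
case: ifPn => [r1|]; last rewrite -leNgt => r1.
- rewrite -X0; apply: ae_eq_probability => //.
  apply: filterS X01 => t /= Xt; rewrite in_itv/= Xt indicE.
  by case: (t \in _) => /=; split => // h; exfalso; move: h r0 r1; lra.
- rewrite -[RHS](probability_setT P); apply: ae_eq_probability => //.
  apply: filterS X01 => t /= Xt; rewrite in_itv/= Xt indicE; split => // _.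
  by case: (t \in _) => /=; move: r0 r1; lra.
Qed.

(** The equality holds everywhere and not only on ]0, 1]: for u <= 0 and for
    u > 1 the defining set is the whole line and the empty set, whose [inf] is
    0 by convention. *)
Lemma fair_bit_pseudoinverse (X : {RV P >-> R}) : fair_bit P X ->
  pseudoinverse (cdf X) = \1_(`]2^-1, 1]%classic : set R).
Proof.
move=> fX; apply/funext => u; rewrite /pseudoinverse indicE.
have inf_ray (a : R) : inf `[a, +oo[%classic = a by exact: inf_itv.
under eq_set do rewrite fair_bit_cdf// lee_fin.
have [u0|u0] := leP u 0.
  rewrite [X in inf X](_ : _ = setT).
    rewrite inf_out; first by rewrite memNset//= in_itv/=; apply/negP; lra.
    move=> [_ [m /(_ (m - 1) I)]]; lra.
  by apply/seteqP; split => // x _ /=; case: ifP => _; [|case: ifP => _]; lra.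
have [u1|u1] := ltP 1 u.
  rewrite [X in inf X](_ : _ = set0).
    by rewrite inf0 memNset//= in_itv/=; apply/negP; lra.
  by apply/seteqP; split => // x /=; case: ifP => _; [|case: ifP => _]; lra.
have [u2|u2] := leP u 2^-1.
  rewrite [X in inf X](_ : _ = `[0, +oo[%classic).
    by rewrite inf_ray memNset//= in_itv/=; apply/negP; lra.
  apply/seteqP; split => x /=; rewrite in_itv/= andbT.
    by case: ltP => //; lra.
  by move=> x0; rewrite ltNge x0 /=; case: ifP => _; lra.
rewrite [X in inf X](_ : _ = `[1, +oo[%classic).
  by rewrite inf_ray mem_set//= in_itv/= u2.
apply/seteqP; split => x /=; rewrite in_itv/= andbT.
  by case: ltP => //; [lra|case: ltP => //; lra].
by move=> x1; rewrite !ltNge x1 (le_trans ler01 x1).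
Qed.

End quantile.

(** * Convexity parameters of fair bits *)

Section uniform.
Variable R : realType.
Let U : probability _ R := uniform_prob (@ltr01 R).

Lemma uniform_prob01 (I : set R) : measurable I -> I `<=` `[0, 1]%classic ->
  U I = lebesgue_measure I.
Proof.
move=> mI I01.
rewrite -[LHS]/(\int[lebesgue_measure]_(x in I) (uniform_pdf 0 1 x)%:E)%E.
rewrite (eq_integral (cst 1%E)); last first.
  move=> x; rewrite inE => /I01 /=; rewrite in_itv/= /uniform_pdf => ->.
  by rewrite subr0 invr1.
by rewrite integral_cst// mul1e.
Qed.

Lemma preimage_indic1 (I : set R) : (\1_I : R -> R) @^-1` [set 1] = I.
Proof.
apply/seteqP; split => x /=; rewrite indicE.
  by case: (boolP (x \in I)) => [/set_mem//|_ /= /eqP]; rewrite eq_sym oner_eq0.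
by move=> Ix; rewrite mem_set.
Qed.

Lemma preimage_indic0 (I : set R) : (\1_I : R -> R) @^-1` [set 0] = ~` I.
Proof.
apply/seteqP; split => x /=; rewrite indicE.
  by move=> + Ix; rewrite mem_set//= => /eqP; rewrite oner_eq0.
by move=> Ix; rewrite memNset.
Qed.

Lemma fair_bit_indic (I : set R) : measurable I -> U I = (2^-1)%:E ->
  fair_bit U (\1_I).
Proof.
move=> mI UI; split; first exact: measurable_indic.
- by rewrite preimage_indic1.
- by rewrite preimage_indic0 probability_setC// UI -EFinB; congr EFin; lra.
Qed.

(* The quantile functions of fair bits at U and at 1 - U are the indicators of
   [upper] and [lower]: equal halves of [0, 1] that are disjoint. *)
Let upper : set R := `]2^-1, 1]%classic.
Let lower : set R := `[0, 2^-1[%classic.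

Let fair_upper : fair_bit U \1_upper.
Proof.
apply: fair_bit_indic; first exact: measurable_itv.
rewrite uniform_prob01; [|exact: measurable_itv|].
  rewrite lebesgue_measure_itv/= lte_fin ifT; last by lra.
  by rewrite -EFinB; congr EFin; lra.
by move=> x; rewrite /upper/= !in_itv/=; lra.
Qed.

Let fair_lower : fair_bit U \1_lower.
Proof.
apply: fair_bit_indic; first exact: measurable_itv.
rewrite uniform_prob01; [|exact: measurable_itv|].
  rewrite lebesgue_measure_itv/= lte_fin ifT; last by lra.
  by rewrite -EFinB; congr EFin; lra.
by move=> x; rewrite /lower/= !in_itv/=; lra.
Qed.

Context d (T : measurableType d) (P : probability T R) (X Y : {RV P >-> R}).
Hypotheses (fX : fair_bit P X) (fY : fair_bit P Y).

Lemma fair_bit_rho_plus : rho_plus X Y = 1.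
Proof.
rewrite /rho_plus !fair_bit_pseudoinverse// fair_bit_correlation//.
rewrite preimage_indic1 setIid; case: fair_upper => _.
rewrite preimage_indic1 => -> _ /=; lra.
Qed.

Lemma fair_bit_rho_minus : rho_minus X Y = -1.
Proof.
rewrite /rho_minus !fair_bit_pseudoinverse//.
rewrite [X in correlation _ _ X](_ : _ = \1_lower); last first.
  apply/funext => u; rewrite !indicE; congr (_ %:R); congr nat_of_bool.
  by apply/idP/idP; rewrite !inE /lower/= !in_itv/=; lra.
rewrite fair_bit_correlation// !preimage_indic1.
rewrite (_ : _ `&` _ = set0) ?measure0/=; first lra.
by apply/seteqP; split => // x [] /=; rewrite /lower/= !in_itv/=; lra.
Qed.

(** Both sides say corr(X, Y) = 2 l - 1, as the extreme correlations are 1 and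
    -1.  Since P(X = Y = 0) = P(X = Y = 1) for fair bits, l is the probability
    that X and Y agree. *)
Lemma fair_bit_convexity_parameter l : is_convexity_parameter X Y l <->
  0 <= l <= 1 /\ fine (P (X @^-1` [set 1] `&` Y @^-1` [set 1])) = l / 2.
Proof.
rewrite /is_convexity_parameter fair_bit_rho_plus fair_bit_rho_minus.
rewrite fair_bit_correlation//; set p := fine _.
split=> [[_ _ _ _ [[l01 pl] _]]|[l01 pl]].
  by split => //; move: pl; lra.
split; try exact: fair_bit_finite_second_moment;
  try exact: fair_bit_nondegenerate.
by split; [split => //; lra|move=> m [_]; lra].
Qed.

End uniform.

(** * Triangle inequalities for agreement probabilities *)

Section necessity.
Context d (T : measurableType d) (R : realType) (P : probability T R).
Implicit Types A B C : set T.
Let p A := fine (P A).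

Lemma fine_probability_le A B : measurable A -> measurable B -> A `<=` B ->
  p A <= p B.
Proof.
move=> mA mB AB; rewrite fine_le ?fin_num_measure//.
by apply: le_measure => //; rewrite inE.
Qed.

Lemma fine_probabilityU A B : measurable A -> measurable B ->
  p (A `|` B) = p A + p B - p (A `&` B).
Proof.
move=> mA mB; rewrite /p.
have -> : (P (A `|` B) = P A + P B - P (A `&` B))%E.
  by apply: measureUfinl => //; rewrite ltey_eq fin_num_measure.
rewrite fineB ?fineD ?fin_numD ?fin_num_measure//; exact: measurableI.
Qed.

(** The parts of A inside B and inside C overlap only within B `&` C. *)
Lemma probability_pairs_le A B C : measurable A -> measurable B ->
  measurable C -> p (A `&` B) + p (A `&` C) <= p A + p (B `&` C).
Proof.
move=> mA mB mC.
have mAB := measurableI _ _ mA mB; have mAC := measurableI _ _ mA mC.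
have mBC := measurableI _ _ mB mC.
have := fine_probabilityU mAB mAC.
have : p (A `&` B `|` A `&` C) <= p A.
  by apply: fine_probability_le => //; [exact: measurableU|move=> x [] []].
have : p (A `&` B `&` (A `&` C)) <= p (B `&` C).
  apply: fine_probability_le => //; first exact: measurableI.
  by move=> x [[_ ?] [_ ?]].
lra.
Qed.

(** Bonferroni's bound P(A `|` B `|` C) >= S1 - S2, combined with P <= 1. *)
Lemma probability_union3_le A B C : measurable A -> measurable B ->
  measurable C ->
  p A + p B + p C <= 1 + (p (A `&` B) + p (A `&` C) + p (B `&` C)).
Proof.
move=> mA mB mC.
have mAB := measurableI _ _ mA mB; have mAC := measurableI _ _ mA mC.
have mBC := measurableU _ _ mB mC.
have := fine_probabilityU mA mBC; have := fine_probabilityU mB mC.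
have := fine_probabilityU mAB mAC; rewrite -setIUr.
have : 0 <= p (A `&` B `&` (A `&` C)) by exact: fine_ge0.
have : p (A `|` (B `|` C)) <= 1.
  rewrite -[leRHS]/(fine 1%E) -(probability_setT P).
  by apply: fine_probability_le => //; exact: measurableU.
lra.
Qed.

End necessity.

(** The events A_i = (B_i = 1) satisfy P(A_i) = 1/2 and
    P(A_i `&` A_j) = lam i j / 2, so these are the two bounds above on the
    intersections of three events, multiplied by 2. *)
Lemma bernoulli_vector_triangle (R : realType) n (lam : 'I_n -> 'I_n -> R) :
  symmetric_unit_array lam -> bernoulli_vector_exists lam ->
  forall i j k, i != j -> i != k -> j != k ->
  1 <= lam i j + lam i k + lam j k /\ lam i j + lam i k <= 1 + lam j k.
Proof.
move=> [lamC _] [d [T [P [B [B01 Blam]]]]] i j k ij ik jk.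
have fB x : fair_bit P (B x).
  by split; [exact: measurable_funP|apply: (B01 x).1|apply: (B01 x).2].
have mB x := fair_bit_measurable_preimage 1 (fB x).
have half x : fine (P (B x @^-1` [set 1])) = 2^-1 by rewrite (B01 x).1.
have agree x y : x != y ->
    fine (P (B x @^-1` [set 1] `&` B y @^-1` [set 1])) = lam x y / 2.
  move=> xy; case: (ltngtP x y) => [lt_xy|lt_yx|/val_inj eq_xy].
  - by have /fair_bit_convexity_parameter[] := Blam x y lt_xy.
  - rewrite setIC lamC.
    by have /fair_bit_convexity_parameter[] := Blam y x lt_yx.
  - by rewrite eq_xy eqxx in xy.
have := probability_pairs_le P (mB i) (mB j) (mB k).
have := probability_union3_le P (mB i) (mB j) (mB k).
by rewrite !half !agree//; lra.
Qed.

(** * Fair bits from a random cut *)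

Section cuts.
Variable R : realType.

Lemma sum_double (f : nat -> R) N :
  \sum_(m < N.*2) f m = \sum_(k < N) (f k.*2 + f k.*2.+1).
Proof.
elim: N => [|N IH]; first by rewrite !big_ord0.
by rewrite doubleS !big_ord_recr /= IH addrA.
Qed.

Variables (N : nat) (w : nat -> R).
Hypotheses (w_ge0 : forall k, 0 <= w k) (w_sum : \sum_(k < N) w k = 1).

Let half_w_ge0 m : 0 <= w m./2 / 2.
Proof. by rewrite divr_ge0. Qed.

(** The outcome m encodes the cut m./2 and the coin toss [odd m]. *)
Definition cut_measure : {measure set nat -> \bar R} :=
  msum (fun m => mscale (NngNum (half_w_ge0 m)) (dirac m)) N.*2.

(** The total mass is already 1: normalizing changes nothing and is a way to
    obtain a bundled probability. *)
Definition cut_probability : probability nat R :=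
  mnormalize cut_measure (dirac 0%N).

Let cut_measureE A :
  cut_measure A =
  (\sum_(k < N) w k / 2 * ((k.*2 \in A)%:R + (k.*2.+1 \in A)%:R))%:E.
Proof.
transitivity (\sum_(m < N.*2) (w m./2 / 2 * ((m : nat) \in A)%:R)%:E)%E.
  apply: eq_bigr => m _.
  by rewrite -[LHS]/((w m./2 / 2)%:E * (\1_A (m : nat))%:E)%E indicE EFinM.
rewrite sumEFin (sum_double (fun m => w m./2 / 2 * (m \in A)%:R)).
congr EFin; apply: eq_bigr => k _.
by rewrite doubleK -[k.*2.+1]/(true + k.*2)%N half_bit_double mulrDr.
Qed.

Lemma cut_probabilityE A : cut_probability A =
  (\sum_(k < N) w k / 2 * ((k.*2 \in A)%:R + (k.*2.+1 \in A)%:R))%:E.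
Proof.
have mu1 : cut_measure setT = 1%E.
  rewrite cut_measureE -[in RHS]w_sum; congr EFin; apply: eq_bigr => k _.
  by rewrite !in_setT /=; field.
rewrite /cut_probability /= /mnormalize /= mu1 /= onee_eq0 /= invr1 mule1.
by rewrite cut_measureE.
Qed.

(** [c k i] is the side of the k-th cut on which the point i lies.  The coin
    gives the value 1 to either side with probability 1/2, so each bit is fair,
    and two bits agree exactly when the cut does not separate their indices. *)
Lemma bernoulli_vector_of_cuts n (lam : 'I_n -> 'I_n -> R)
    (c : nat -> 'I_n -> bool) : symmetric_unit_array lam ->
  (forall i j : 'I_n, (i < j)%N ->
     \sum_(k < N) w k * (c k i == c k j)%:R = lam i j) ->
  bernoulli_vector_exists lam.
Proof.
move=> [_ lam01] agree.
pose b (i : 'I_n) (m : nat) : R := (odd m (+) c m./2 i)%:R.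
have mb i : measurable_fun setT (b i) by [].
pose B i : {RV cut_probability >-> R} := mfun_Sub (mem_set (mb i)).
have bit1 i m : (m \in B i @^-1` [set 1]) = odd m (+) c m./2 i.
  apply/idP/idP => [/set_mem /=|h]; last by apply/mem_set => /=; rewrite /b h.
  by rewrite /b; case: (_ (+) _) => //= /eqP; rewrite eq_sym oner_eq0.
have bit0 i m : (m \in B i @^-1` [set 0]) = ~~ (odd m (+) c m./2 i).
  apply/idP/idP => [/set_mem /=|h]; last
    by apply/mem_set => /=; rewrite /b (negbTE h).
  by rewrite /b; case: (_ (+) _) => //= /eqP; rewrite oner_eq0.
have half1 : \sum_(k < N) w k / 2 = 2^-1.
  by rewrite -mulr_suml w_sum mul1r.
have B01 i : cut_probability (B i @^-1` [set 1]) = (2^-1)%:E /\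
             cut_probability (B i @^-1` [set 0]) = (2^-1)%:E.
  split; rewrite cut_probabilityE -[in RHS]half1; congr EFin;
    apply: eq_bigr => k _.
    rewrite !bit1 /= odd_double uphalf_double doubleK.
    by case: (c _ _) => /=; field.
  rewrite !bit0 /= odd_double uphalf_double doubleK.
  by case: (c _ _) => /=; field.
exists _, nat, cut_probability, B; split => // i j ij.
apply/fair_bit_convexity_parameter.
- by case: (B01 i); split => //.
- by case: (B01 j); split => //.
split; first exact: lam01.
rewrite cut_probabilityE /= -(agree _ _ ij) mulr_suml; apply: eq_bigr => k _.
rewrite !in_setI !bit1 /= odd_double uphalf_double doubleK.
by case: (c _ _); case: (c _ _) => /=; field.
Qed.

End cuts.

(** * Cut decompositions of four points *)

(** The arguments are agreement probabilities x = 1 - d: in terms of the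
    distances d these are the three triangle inequalities and the bound 2 on
    the perimeter. *)
Definition triangle_inequalities (R : realType) (x y z : R) : Prop :=
  [/\ 1 <= x + y + z, x + y <= 1 + z, x + z <= 1 + y & y + z <= 1 + x].

(** The i-th binary digit of k: as k runs through 0, ..., 7 the digits 0 to 3
    run once through the cuts of four points, each cut being represented by the
    side that does not contain the last point. *)
Definition binary_cut (k i : nat) : bool := odd (iter i half k).

(** Every restriction to three points determines the weights of the cuts of
    those points.  Taking the triple 123, and then the triples through 4, all
    weights are expressed by that of the cut isolating the point 4, named t. *)
Lemma four_point_cuts (R : realType) (x12 x13 x14 x23 x24 x34 : R) :
  triangle_inequalities x12 x13 x23 -> triangle_inequalities x12 x14 x24 ->
  triangle_inequalities x13 x14 x34 -> triangle_inequalities x23 x24 x34 ->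
  exists w : nat -> R, [/\ forall k, 0 <= w k, \sum_(k < 8) w k = 1 &
    let agree i j :=
      \sum_(k < 8) w k * (binary_cut k i == binary_cut k j)%:R in
    [/\ agree 0 1 = x12, agree 0 2 = x13 & agree 0 3 = x14]%N /\
    [/\ agree 1 2 = x23, agree 1 3 = x24 & agree 2 3 = x34]%N].
Proof.
move=> [? ? ? ?] [? ? ? ?] [? ? ? ?] [? ? ? ?].
(* Within the points 1, 2, 3, the weight of separating nothing is q0 and that of
   isolating the point i is qi.  Within 4 and the two points other than i, the
   weight of isolating 4 is mi. *)
pose q0 := (x12 + x13 + x23 - 1) / 2.
pose q1 := (1 - x12 - x13 + x23) / 2.
pose q2 := (1 - x12 - x23 + x13) / 2.
pose q3 := (1 - x13 - x23 + x12) / 2.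
pose m1 := (1 - x24 - x34 + x23) / 2.
pose m2 := (1 - x14 - x34 + x13) / 2.
pose m3 := (1 - x14 - x24 + x12) / 2.
have [t [t_lo t_up]] : exists t : R,
    [/\ 0 <= t, m1 - q1 <= t, m2 - q2 <= t & m3 - q3 <= t] /\
    [/\ t <= q0, t <= m1, t <= m2 & t <= m3].
  exists (Num.max (Num.max 0 (m1 - q1)) (Num.max (m2 - q2) (m3 - q3))).
  rewrite !ge_max !le_max !lexx !orbT; split=> //.
  by split; rewrite /q0 /q1 /q2 /q3 /m1 /m2 /m3; lra.
move: t_lo t_up => [? ? ? ?] [? ? ? ?].
(* In four points, isolating 4 within that triple means isolating 4 or pairing
   it with i, so the pairing {i, 4} has weight mi - t; likewise isolating i
   has weight qi - (mi - t).  The list follows the binary order of the cuts. *)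
exists (nth 0 [:: q0 - t; q1 - m1 + t; q2 - m2 + t; m3 - t;
                  q3 - m3 + t; m2 - t; m1 - t; t]).
split.
- by case=> [|[|[|[|[|[|[|[|k]]]]]]]] //=; rewrite ?nth_nil; lra.
- by rewrite !big_ord_recl big_ord0 /= /q0 /q1 /q2 /q3 /m1 /m2 /m3; field.
- rewrite /= !big_ord_recl !big_ord0 /= /q0 /q1 /q2 /q3 /m1 /m2 /m3.
  by split; split; field.
Qed.

Lemma entryS (R : realType) n (lam : 'I_n.+1 -> 'I_n.+1 -> R) (i j : 'I_n.+1) :
  entry lam i.+1 j.+1 = lam i j.
Proof. by rewrite /entry /= !inord_val. Qed.

(** * Vectors of two, three and four fair bits *)

Section up_to_four_points.
Variable R : realType.

(** The four-point decomposition with the points 2, 3, 4 identified. *)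
Lemma bernoulli_vector2 (lam : 'I_2 -> 'I_2 -> R) :
  symmetric_unit_array lam -> bernoulli_vector_exists lam.
Proof.
move=> sym; have l01 := sym.2 ord0 ord_max isT.
rewrite -entryS /= in l01.
have tri1 : triangle_inequalities (entry lam 1 2) (entry lam 1 2) 1.
  by split; lra.
have tri2 : triangle_inequalities (1 : R) 1 1 by split; lra.
have [w [w_ge0 w_sum [[w12 _ _] _]]] := four_point_cuts tri1 tri1 tri1 tri2.
apply: (bernoulli_vector_of_cuts w_ge0 w_sum
  (c := fun k i => binary_cut k i)) => //.
by move=> i j; rewrite -entryS; case: i j => [[|[|//]] ?] [[|[|//]] ?].
Qed.

Lemma bernoulli_vector_triangle_entry n (lam : 'I_n.+1 -> 'I_n.+1 -> R) :
  symmetric_unit_array lam -> bernoulli_vector_exists lam ->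
  forall i j k, (i < j)%N -> (j < k)%N -> (k < n.+1)%N ->
  triangle_inequalities
    (entry lam i.+1 j.+1) (entry lam i.+1 k.+1) (entry lam j.+1 k.+1).
Proof.
move=> sym vec i j k ij jk kn.
have jn := ltn_trans jk kn; have in_ := ltn_trans ij jn.
have lamC x y : entry lam x y = entry lam y x by exact: sym.1.
have ineq a b c : (a < n.+1)%N -> (b < n.+1)%N -> (c < n.+1)%N ->
    a != b -> a != c -> b != c ->
    1 <= entry lam a.+1 b.+1 + entry lam a.+1 c.+1 + entry lam b.+1 c.+1 /\
    entry lam a.+1 b.+1 + entry lam a.+1 c.+1 <= 1 + entry lam b.+1 c.+1.
  move=> an bn cn ab ac bc.
  by apply: bernoulli_vector_triangle => //; rewrite -val_eqE /= !inordK.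
have nij : i != j by rewrite neq_ltn ij.
have nik : i != k by rewrite neq_ltn (ltn_trans ij jk).
have njk : j != k by rewrite neq_ltn jk.
have [? ?] := ineq i j k in_ jn kn nij nik njk.
have := ineq j i k jn in_ kn; rewrite eq_sym => /(_ nij njk nik)[_ ?].
have := ineq k i j kn in_ jn.
rewrite ![k == _]eq_sym (lamC k.+1) (lamC k.+1 j.+1) => /(_ nik njk nij)[_ ?].
have := lamC j.+1 i.+1.
by split; lra.
Qed.

Lemma bernoulli_vector3 (lam : 'I_3 -> 'I_3 -> R) :
  symmetric_unit_array lam -> bernoulli_vector_exists lam <->
  triangle_inequalities (entry lam 1 2) (entry lam 1 3) (entry lam 2 3).
Proof.
move=> sym; split=> [vec|tri].
  exact: (bernoulli_vector_triangle_entry sym vec (i := 0) (j := 1) (k := 2)).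
(* Sufficiency is the four-point decomposition with the point 4 identified with
   the point 3. *)
have l13 := sym.2 ord0 ord_max isT; have l23 := sym.2 (inord 1) ord_max.
rewrite -entryS /= in l13; rewrite -entryS /= inordK// in l23.
have {}l23 := l23 isT.
have tri13 : triangle_inequalities (entry lam 1 3) (entry lam 1 3) 1.
  by split; lra.
have tri23 : triangle_inequalities (entry lam 2 3) (entry lam 2 3) 1.
  by split; lra.
have [w [w_ge0 w_sum [[w12 w13 _] [w23 _ _]]]] :=
  four_point_cuts tri tri tri13 tri23.
apply: (bernoulli_vector_of_cuts w_ge0 w_sum
  (c := fun k i => binary_cut k i)) => //.
move=> i j; rewrite -entryS.
by case: i j => [[|[|[|//]]] ?] [[|[|[|//]]] ?].
Qed.

Lemma bernoulli_vector4 (lam : 'I_4 -> 'I_4 -> R) :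
  symmetric_unit_array lam -> bernoulli_vector_exists lam <->
  [/\ triangle_inequalities (entry lam 1 2) (entry lam 1 3) (entry lam 2 3),
      triangle_inequalities (entry lam 1 2) (entry lam 1 4) (entry lam 2 4),
      triangle_inequalities (entry lam 1 3) (entry lam 1 4) (entry lam 3 4) &
      triangle_inequalities (entry lam 2 3) (entry lam 2 4) (entry lam 3 4)].
Proof.
move=> sym; split=> [vec|[tri123 tri124 tri134 tri234]].
  have tri := bernoulli_vector_triangle_entry sym vec.
  split; [exact: (tri 0 1 2)%N|exact: (tri 0 1 3)%N|
          exact: (tri 0 2 3)%N|exact: (tri 1 2 3)%N].
have [w [w_ge0 w_sum [[w12 w13 w14] [w23 w24 w34]]]] :=
  four_point_cuts tri123 tri124 tri134 tri234.
apply: (bernoulli_vector_of_cuts w_ge0 w_sum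
  (c := fun k i => binary_cut k i)) => //.
move=> i j; rewrite -entryS.
by case: i j => [[|[|[|[|//]]]] ?] [[|[|[|[|//]]]] ?].
Qed.

End up_to_four_points.

Theorem theorem3 (R : realType) :
  (forall lam : 'I_2 -> 'I_2 -> R, symmetric_unit_array lam ->
     bernoulli_vector_exists lam)
  /\
  (forall lam : 'I_3 -> 'I_3 -> R, symmetric_unit_array lam ->
     bernoulli_vector_exists lam <->
       (1 + 2 * Num.min (entry lam 2 3) (Num.min (entry lam 1 2) (entry lam 1 3))
          >= entry lam 2 3 + entry lam 1 2 + entry lam 1 3)
       /\ (entry lam 2 3 + entry lam 1 2 + entry lam 1 3 >= 1))
  /\
  (forall lam : 'I_4 -> 'I_4 -> R, symmetric_unit_array lam ->
     let ell :=
       Num.max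
         (entry lam 1 4 + entry lam 2 4 + entry lam 1 3 + entry lam 2 3)
         (Num.max
           (entry lam 1 4 + entry lam 3 4 + entry lam 1 2 + entry lam 2 3)
           (entry lam 2 4 + entry lam 3 4 + entry lam 1 2 + entry lam 1 3)) in
     let u :=
       Num.min
         (entry lam 1 2 + entry lam 2 3 + entry lam 1 3)
         (Num.min
           (entry lam 1 2 + entry lam 2 4 + entry lam 1 4)
           (Num.min
             (entry lam 1 3 + entry lam 3 4 + entry lam 1 4)
             (entry lam 2 3 + entry lam 3 4 + entry lam 2 4))) in
     bernoulli_vector_exists lam <-> (ell <= u + 1) /\ (1 <= u)).
Proof.
split; first exact: bernoulli_vector2.
split=> lam sym.
  apply: (iff_trans (bernoulli_vector3 sym)).
  (* Bring the minimum alone to one side, to split it into its entries. *)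
  rewrite -lerBlDl -ler_pdivrMl// !le_min.
  split=> [[? ? ? ?]|[/and3P[? ? ?] ?]]; last by split; lra.
  by split; [apply/and3P; split|]; lra.
move=> ell u; apply: (iff_trans (bernoulli_vector4 sym)).
(* ell <= u + 1 splits into twelve comparisons of a four-cycle sum with a triple
   sum; two of the three terms of the triple cancel in each. *)
rewrite -lerBlDr /ell /u !le_min !lerBlDr !ge_max.
split=> [[[? ? ? ?] [? ? ? ?] [? ? ? ?] [? ? ? ?]]|].
  by split; apply/and4P; split; try (apply/and3P; split); lra.
move=> [/and4P[/and3P[? ? ?] /and3P[? ? ?] /and3P[? ? ?] /and3P[? ? ?]]].
by move=> /and4P[? ? ? ?]; split; split; lra.
Qed.
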